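(* Let $f\colon\mathbf{R}^n\to\overline{\mathbf{R}}$ be a lower semicontinuous symmetric function, and let $X\in\mathbf{S}^n$ be a matrix with $f(\lambda(X))$ finite. Then the limiting subdifferential of the function $f\circ\lambda\colon\mathbf{S}^n\to\overline{\mathbf{R}}$ satisfies $$\partial (f\circ \lambda)(X)=\big\{U(\operatorname{Diag} v)U^T: v\in\partial f(\lambda(X)),\ U\in \mathcal{O}_{X}\big\}.$$ The analogous formulas hold for the proximal, Fréchet, and horizon subdifferentials, that is, $$\partial_p (f\circ \lambda)(X)=\big\{U(\operatorname{Diag} v)U^T: v\in\partial_p f(\lambda(X)),\ U\in \mathcal{O}_{X}\big\},$$ $$\hat\partial (f\circ \lambda)(X)=\big\{U(\operatorname{Diag} v)U^T: v\in\hat\partial f(\lambda(X)),\ U\in \mathcal{O}_{X}\big\},$$ $$\partial^\infty (f\circ \lambda)(X)=\big\{U(\operatorname{Diag} v)U^T: v\in\partial^\infty f(\lambda(X)),\ U\in \mathcal{O}_{X}\big\}.$$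
   Context: $\overline{\mathbf{R}}=\mathbf{R}\cup\{\pm\infty\}$. $\mathbf{R}^n$ carries the usual dot product. $\mathbf{S}^n$ is the space of real symmetric $n\times n$ matrices with the trace inner product $\langle X,Y\rangle=\operatorname{tr}(XY)$ and Frobenius norm. $\mathcal{O}^n$ is the group of real orthogonal $n\times n$ matrices. $\operatorname{Diag}x$ is the diagonal matrix with $x$ on its diagonal. $\lambda\colon\mathbf{S}^n\to\mathbf{R}^n$ assigns to $X$ its vector of eigenvalues $(\lambda_1(X),\dots,\lambda_n(X))$ (with multiplicity) in nonincreasing order. $\mathcal{O}_X:=\{U\in\mathcal{O}^n: U(\operatorname{Diag}\lambda(X))U^T=X\}$. A function $f\colon\mathbf{R}^n\to\overline{\mathbf{R}}$ is symmetric if $f(\pi x)=f(x)$ for all $x\in\mathbf{R}^n$ and all coordinate permutations $\pi$. Subdifferentials. Let $\mathbf{E}$ be a Euclidean space (finite-dimensional real inner product space) with norm $|\cdot|$, $g\colon\mathbf{E}\to\overline{\mathbf{R}}$ and $\bar x\in\mathbf{E}$ with $g(\bar x)$ finite (subdifferentials are considered only at points where the function is finite). - Proximal subdifferential $\partial_p g(\bar x)$: all $v\in\mathbf{E}$ for which there exist $r>0$ and $\varepsilon>0$ with $g(x)\ge g(\bar x)+\langle v,x-\bar x\rangle-\frac r2|x-\bar x|^2$ for all $x$ with $|x-\bar x|\le\varepsilon$. - Fréchet subdifferential $\hat\partial g(\bar x)$: all $v\in\mathbf{E}$ with $g(x)\ge g(\bar x)+\langle v,x-\bar x\rangle+o(|x-\bar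 x|)$ as $x\to\bar x$. - Limiting subdifferential $\partial g(\bar x)$: all $v\in\mathbf{E}$ for which there are sequences $x_i$ and $v_i\in\hat\partial g(x_i)$ with $(x_i,g(x_i),v_i)\to(\bar x,g(\bar x),v)$. - Horizon subdifferential $\partial^\infty g(\bar x)$: all limits of $\lambda_i v_i$ for sequences $v_i\in\partial g(x_i)$ and reals $\lambda_i\ge 0$ with $x_i\to\bar x$ and $\lambda_i\searrow 0$. *)

(* Defs.v *)
From HB Require Import structures.
From mathcomp Require Import all_boot all_order all_algebra all_fingroup.
From mathcomp Require Import all_classical all_reals all_analysis.
From mathcomp Require complex.

Set Implicit Arguments.
Unset Strict Implicit.
Unset Printing Implicit Defensive.

Import Order.TTheory GRing.Theory Num.Theory.
Import numFieldNormedType.Exports.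

Local Open Scope classical_set_scope.
Local Open Scope ring_scope.

(* A Euclidean space is a finite-dimensional real space [E : vectType R] with a
   positive definite symmetric bilinear form [ip : {dot E for idfun}].  Its norm
   and convergence are derived from [ip]; the sup norm that the library puts on
   matrices is not used. *)
Section Subdifferentials.
Context {R : realType} {E : vectType R} (ip : {dot E for idfun}).
Implicit Types (g : E -> \bar R) (x v : E).

Definition enorm x : R := Num.sqrt (ip x x).

Definition ecvg (u : nat -> E) (l : E) : Prop :=
  (fun i => enorm (u i - l)) @ \oo --> (0 : R).

Definition proximal_subdiff g xbar : set E := [set v |
  g xbar \is a fin_num /\
  exists r eps : R, [/\ 0 < r, 0 < eps &
    forall x, enorm (x - xbar) <= eps ->
      (g xbar + (ip v (x - xbar))%:E
         - (r / 2 * enorm (x - xbar) ^+ 2)%:E <= g x)%E]].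

(* The remainder o(|x - xbar|) is written out in epsilon-delta form. *)
Definition frechet_subdiff g xbar : set E := [set v |
  g xbar \is a fin_num /\
  forall eps : R, 0 < eps -> exists2 delta : R, 0 < delta &
    forall x, enorm (x - xbar) <= delta ->
      (g xbar + (ip v (x - xbar))%:E
         - (eps * enorm (x - xbar))%:E <= g x)%E].

Definition limiting_subdiff g xbar : set E := [set v |
  g xbar \is a fin_num /\
  exists x_ v_ : nat -> E,
    [/\ forall i, frechet_subdiff g (x_ i) (v_ i),
        ecvg x_ xbar,
        (fun i => g (x_ i)) @ \oo --> g xbar &
        ecvg v_ v]].

Definition horizon_subdiff g xbar : set E := [set w |
  g xbar \is a fin_num /\
  exists (x_ v_ : nat -> E) (t_ : nat -> R),
    [/\ forall i, limiting_subdiff g (x_ i) (v_ i),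
        forall i, 0 <= t_ i,
        ecvg x_ xbar,
        nonincreasing_seq t_ /\ t_ @ \oo --> (0 : R) &
        ecvg (fun i => t_ i *: v_ i) w]].

End Subdifferentials.

Section DotProduct.
Context {R : realType} {n : nat}.

Definition dotv (u v : 'rV[R]_n) : R := \sum_(i < n) u 0 i * v 0 i.

Fact dotvC (u v : 'rV[R]_n) : dotv u v = (-1) ^+ false * dotv v u.
Proof. by rewrite mul1r; apply: eq_bigr => i _; rewrite mulrC. Qed.

Fact dotvDl (w : 'rV[R]_n) : linear_for *%R (dotv ^~ w).
Proof.
move=> a u v; rewrite /dotv /= big_distrr -big_split.
by apply: eq_bigr => i _ /=; rewrite !mxE mulrDl mulrA.
Qed.

Fact dotvDr (w : 'rV[R]_n) : linear_for (idfun \; *%R) (dotv w).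
Proof.
move=> a u v; rewrite /dotv /= big_distrr -big_split.
by apply: eq_bigr => i _ /=; rewrite !mxE mulrDr mulrCA.
Qed.

Fact dotv_gt0 (u : 'rV[R]_n) : u != 0 -> 0 < dotv u u.
Proof.
move=> u0; rewrite lt0r sumr_ge0 ?andbT; last by move=> i _; rewrite -expr2 sqr_ge0.
apply: contra u0; rewrite psumr_eq0; last by move=> i _; rewrite -expr2 sqr_ge0.
move=> /allP u0; apply/eqP/rowP => i; rewrite mxE; apply/eqP.
by have := u0 i (mem_index_enum _); rewrite -expr2 sqrf_eq0.
Qed.

HB.instance Definition _ := @bilinear_isBilinear.Build R 'rV[R]_n 'rV[R]_n R
  *%R (idfun \; *%R) dotv (dotvDl, dotvDr).
HB.instance Definition _ :=
  @isHermitianSesquilinear.Build R 'rV[R]_n false idfun dotv dotvC.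
HB.instance Definition _ := @isDotProduct.Build R 'rV[R]_n dotv dotv_gt0.

End DotProduct.

Section SymmetricMatrices.
Context {R : realType} {n : nat}.

Definition is_symmx : {pred 'M[R]_n} := fun A => A^T == A.

Fact is_symmx_submod : submod_closed is_symmx.
Proof.
split=> [|a A B]; rewrite !unfold_in /is_symmx ?trmx0 // => /eqP sA /eqP sB.
by rewrite linearP /= sA sB.
Qed.

HB.instance Definition _ :=
  GRing.isSubmodClosed.Build R 'M[R]_n is_symmx is_symmx_submod.

Record symmx := SymMx { symmx_val :> 'M[R]_n; _ : symmx_val \in is_symmx }.

HB.instance Definition _ := [isSub for symmx_val].
HB.instance Definition _ := [Choice of symmx by <:].
HB.instance Definition _ := [SubChoice_isSubLmodule of symmx by <:].


Let symv : {vspace 'M[R]_n} := lker (linfun (fun A : 'M[R]_n => A^T - A)).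

Let mem_symv A : (A \in symv) = (A \in is_symmx).
Proof.
have lin : linear (fun A : 'M[R]_n => A^T - A).
  by move=> a B C; rewrite linearP scalerBr opprD addrACA.
pose h := HB.pack_for {linear 'M[R]_n -> 'M[R]_n} (fun A : 'M[R]_n => A^T - A)
  (GRing.isLinear.Build _ _ _ _ _ lin).
by rewrite memv_ker (lfunE h) subr_eq0 unfold_in.
Qed.

Fact symmx_vect_iso : Vector.axiom (\dim symv) symmx.
Proof.
have [f lf bf] := subvs_vect_iso symv.
exists (fun A : symmx => f (vsproj symv (val A))).
  by move=> a A B; rewrite -lf -linearP.
have pf (w : subvs_of symv) : val w \in is_symmx by rewrite -mem_symv subvsP.
have bp : bijective (fun A : symmx => vsproj symv (val A)).
  exists (fun w => SymMx (pf w)) => [A|w]; last by rewrite /= vsvalK.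
  by apply: val_inj; rewrite /= vsprojK // mem_symv; case: A.
exact: (bij_comp bf bp).
Qed.

HB.instance Definition _ := Lmodule_hasFinDim.Build R symmx symmx_vect_iso.

Definition trdot (A B : symmx) : R := \tr (A *m B).

Fact trdotC (A B : symmx) : trdot A B = (-1) ^+ false * trdot B A.
Proof. by rewrite mul1r /trdot mxtrace_mulC. Qed.

Fact trdotDl (C : symmx) : linear_for *%R (trdot ^~ C).
Proof. by move=> a A B; rewrite /trdot /= mulmxDl -scalemxAl linearP. Qed.

Fact trdotDr (C : symmx) : linear_for (idfun \; *%R) (trdot C).
Proof. by move=> a A B; rewrite /trdot /= mulmxDr -scalemxAr linearP. Qed.

Fact trdot_gt0 (A : symmx) : A != 0 -> 0 < trdot A A.
Proof.
have -> : trdot A A = \sum_i \sum_j A i j ^+ 2.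
  apply: eq_bigr => i _; rewrite mxE; apply: eq_bigr => j _.
  by case: A => A /= /eqP sA; rewrite -{2}sA mxE expr2.
have sq_ge0 i : true -> 0 <= \sum_j A i j ^+ 2.
  by move=> _; apply: sumr_ge0 => j _; exact: sqr_ge0.
move=> A0; rewrite lt0r sumr_ge0 // andbT.
apply: contra A0; rewrite psumr_eq0 // => /allP A0.
apply/eqP/val_inj/matrixP => i j; rewrite mxE.
have := A0 i (mem_index_enum _); rewrite psumr_eq0; last by move=> *; exact: sqr_ge0.
by move=> /allP/(_ j (mem_index_enum _)); rewrite sqrf_eq0 => /eqP.
Qed.

HB.instance Definition _ := @bilinear_isBilinear.Build R symmx symmx R
  *%R (idfun \; *%R) trdot (trdotDl, trdotDr).
HB.instance Definition _ :=
  @isHermitianSesquilinear.Build R symmx false idfun trdot trdotC.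
HB.instance Definition _ := @isDotProduct.Build R symmx trdot trdot_gt0.

End SymmetricMatrices.
Arguments symmx : clear implicits.

Lemma char_poly_conj (F : fieldType) n (P D : 'M[F]_n) :
  P \in unitmx -> char_poly (invmx P *m D *m P) = char_poly D.
Proof.
move=> uP; rewrite /char_poly /char_poly_mx !map_mxM.
have QQ : map_mx polyC (invmx P) *m map_mx polyC P = 1%:M.
  by rewrite -map_mxM mulVmx // map_mx1.
have XE : 'X%:M = map_mx polyC (invmx P) *m 'X%:M *m map_mx polyC P.
  by rewrite scalar_mxC -mulmxA QQ mulmx1.
by rewrite [in LHS]XE -mulmxBl -mulmxBr !det_mulmx mulrAC -det_mulmx QQ det1 mul1r.
Qed.

Section Eigenvalues.
Context {R : realType} {n : nat}.

Definition is_eigvals (A : 'M[R]_n) (l : 'rV[R]_n) : Prop :=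
  char_poly A = \prod_(i < n) ('X - (l 0 i)%:P) /\
  forall i j : 'I_n, (i <= j)%N -> l 0 j <= l 0 i.

(* Every real symmetric matrix has exactly one such vector, see [eigvalsP] and
   [eigvals_uniq]; the default value 0 is never used. *)
Definition eigvals (X : symmx R n) : 'rV[R]_n := xget 0 [set l | is_eigvals X l].

Import complex.

Lemma symmx_char_poly_split (X : symmx R n) :
  exists r : 'rV[R]_n, char_poly (X : 'M[R]_n) = \prod_(i < n) ('X - (r 0 i)%:P).
Proof.
pose rc := real_complex R.
pose A := map_mx rc X.
have sA : A \is symmetricmx.
  apply/is_hermitianmxP; rewrite expr0 scale1r map_mx_id // map_trmx.
  by case: X @A => X /= /eqP ->.
have rA : A \is a mxOver Num.real.
  by apply/mxOverP => i j; rewrite mxE complex_real.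
have hA := realsym_hermsym sA rA.
have rd : spectral_diag A \is a mxOver Num.real by exact: hermitian_spectral_diag_real.
have eA := orthomx_spectralP (hermitian_normalmx hA).
have uP := spectral_unit A.
move: (spectral_diag A) (spectralmx A) rd eA uP => d P /mxOverP rd eA uP.
exists (\row_i complex.Re (d 0 i)).
apply: (map_poly_inj rc).
rewrite map_char_poly -/A eA char_poly_conj //.
rewrite char_poly_trig ?diag_mx_is_trig // rmorph_prod /=.
apply: eq_bigr => i _; rewrite !mxE eqxx mulr1n rmorphB /= map_polyX map_polyC /=.
by rewrite RRe_real.
Qed.

Lemma eigvalsP (X : symmx R n) : is_eigvals X (eigvals X).
Proof.
suff [l lP] : [set l | is_eigvals X l] !=set0 by exact: (xgetPex 0 (ex_intro _ l lP)).
have [r rP] := symmx_char_poly_split X.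
pose s := sort >=%O [seq r 0 i | i <- enum 'I_n].
have ss : size s = n by rewrite size_sort size_map size_enum_ord.
exists (\row_i s`_i); split=> [|i j ij].
  rewrite rP; under [RHS]eq_bigr do rewrite mxE.
  rewrite -(big_mkord xpredT (fun i => 'X - (s`_i)%:P)) -[X in index_iota _ X]ss.
  rewrite -(big_nth 0 xpredT (fun a => 'X - a%:P)).
  rewrite (perm_big [seq r 0 i | i <- enum 'I_n]) ?perm_sort //=.
  by rewrite big_map big_enum.
rewrite !mxE; have := @sorted_leq_nth _ >=%O (@ge_trans _ R) ge_refl 0 s.
by apply; rewrite ?sort_sorted ?inE ?ss //; exact: ge_total.
Qed.

Lemma eigvals_uniq (X : symmx R n) (l : 'rV[R]_n) :
  is_eigvals X l -> l = eigvals X.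
Proof.
move=> [lP ls]; have [eP es] := eigvalsP X.
pose sq (u : 'rV[R]_n) := [seq u 0 i | i <- enum 'I_n].
have sorted_sq (u : 'rV[R]_n) : (forall i j : 'I_n, (i <= j)%N -> u 0 j <= u 0 i) -> sorted >=%O (sq u).
  move=> us; rewrite sorted_map.
  have : sorted (relpre val leq) (enum 'I_n).
    by rewrite -sorted_map val_enum_ord; exact: iota_sorted.
  by apply: sub_sorted => i j /=; exact: us.
have : sq l = sq (eigvals X).
  apply: (@sorted_eq _ >=%O (@ge_trans _ R) (@ge_anti _ R)); try exact: sorted_sq.
  by apply: prod_XsubC_eq; move: eP; rewrite /sq !big_map [in X in X -> _]lP -!big_enum.
move=> /eq_in_map e; apply/rowP => i; apply: e; exact: mem_enum.
Qed.

End Eigenvalues.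

Section Spectral.
Context {R : realType} {n : nat}.

Definition orthogonal_group : set 'M[R]_n := [set U | U *m U^T = 1%:M].

Definition diagonalizers (X : symmx R n) : set 'M[R]_n :=
  [set U | orthogonal_group U /\
           U *m diag_mx (eigvals X) *m U^T = symmx_val X].

Fact conj_diag_symmx (U : 'M[R]_n) (v : 'rV[R]_n) :
  U *m diag_mx v *m U^T \in is_symmx.
Proof. by rewrite unfold_in !trmx_mul trmxK tr_diag_mx mulmxA. Qed.

Definition conj_diag (U : 'M[R]_n) (v : 'rV[R]_n) : symmx R n :=
  SymMx (conj_diag_symmx U v).

Definition symmetric_fun (f : 'rV[R]_n -> \bar R) : Prop :=
  forall (s : 'S_n) (x : 'rV[R]_n), f (col_perm s x) = f x.

End Spectral.

(* Main.v *)
(** The inclusion "superset" rests on a quadratic minorant: if [X = U Diag(x) U^T] and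
    [V = U Diag(v) U^T], a permutation sorting [v + t x] with [t] large also sorts [x],
    and von Neumann's trace inequality for both vectors shows that some rearrangement [y]
    of the eigenvalues of [Y] satisfies [|y - x| <= |Y - X|] and
    [<v, y - x> >= <V, Y - X> - t/2 |Y - X|^2]; this transports Fréchet and proximal
    subgradients of [f].  Conversely, a Fréchet subgradient [V] at [X] is diagonalized by
    some [U] with [U^T X U] diagonal: conjugating [X] by a reflection in two coordinates
    leaves the spectrum unchanged, so the subgradient inequality kills the entries of
    [U^T V U] between distinct eigenvalues, and maximizing a linear functional over the
    compact set of diagonalizers of [X] kills those inside the eigenspaces.  The limiting
    and horizon cases follow by compactness of the orthogonal group and the Lipschitz
    continuity of the eigenvalues. *)
Require Import Defs.
From HB Require Import structures.
From mathcomp Require Import all_boot all_order all_algebra all_fingroup.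
From mathcomp Require Import all_classical all_reals all_analysis.
From mathcomp Require Import ring lra.

Set Implicit Arguments.
Unset Strict Implicit.
Unset Printing Implicit Defensive.

Import Order.TTheory GRing.Theory Num.Theory.
Import numFieldNormedType.Exports.

Local Open Scope classical_set_scope.
Local Open Scope ring_scope.

(** * Sorting permutations and the rearrangement inequality *)

Definition nonincreasing_vec (R : realType) (n : nat) (x : 'rV[R]_n) : Prop :=
  forall i j : 'I_n, (i <= j)%N -> x 0 j <= x 0 i.

Lemma exists_sorting_perm (R : realType) (n : nat) (x : 'rV[R]_n) :
  exists s : 'S_n, nonincreasing_vec (col_perm s x).
Proof.
pose t := [tuple x 0 i | i < n].
have /tuple_permP[p pE] : perm_eq (sort >=%O t) t by rewrite perm_sort.
have eqt i : (sort >=%O t)`_(nat_of_ord i) = x 0 (p i).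
  by rewrite pE -[_`_i]tnth_nth !tnth_mktuple.
exists p => i j ij; rewrite !mxE -!eqt.
have := @sorted_leq_nth _ >=%O (@ge_trans _ R) ge_refl 0 (sort >=%O t).
have ss : size (sort >=%O t) = n by rewrite size_sort size_tuple.
by apply; rewrite ?sort_sorted ?inE ?ss //; exact: ge_total.
Qed.

(* Dual potentials for the rearrangement inequality: with [p i = w i * m i - q i]
   one has [p i + q j >= w i * m j], with equality for [i = j]. *)
Lemma rearrangement_potential (R : realType) (n : nat) (w m : 'rV[R]_n) :
  nonincreasing_vec w -> nonincreasing_vec m ->
  exists q : 'I_n -> R, forall i j, w 0 i * (m 0 j - m 0 i) <= q j - q i.
Proof.
case: n w m => [|n] w m hw hm; first by exists (fun=> 0); case.
pose W k : R := w 0 (inord k); pose M k : R := m 0 (inord k).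
(* A discrete integral of [W] against the increments of [M]. Differences of [q] telescope, and since
   [W] and [M] decrease together, freezing [W] at either end of a range bounds the sum from the
   required side. *)
pose q k : R := \sum_(l < k) W l * (M l.+1 - M l).
have hW k l : (k <= l)%N -> (l < n.+1)%N -> W l <= W k.
  by move=> kl ln; apply: hw; rewrite !inordK // (leq_ltn_trans kl).
have hM k l : (k <= l)%N -> (l < n.+1)%N -> M l <= M k.
  by move=> kl ln; apply: hm; rewrite !inordK // (leq_ltn_trans kl).
(* Induction on the gap [d], treating both orders of the two indices at once. *)
have key i d : (i + d < n.+1)%N ->
    W i * (M (i + d)%N - M i) <= q (i + d)%N - q i /\
    W (i + d)%N * (M i - M (i + d)%N) <= q i - q (i + d)%N.
  elim: d => [|d IH] id; first by rewrite addn0 !subrr !mulr0.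
  rewrite addnS in id *.
  have [IH1 IH2] := IH (ltnW id).
  have qS : q (i + d).+1 = q (i + d)%N + W (i + d)%N * (M (i + d).+1 - M (i + d)%N).
    by rewrite /q big_ord_recr.
  have h1 := hW i (i + d)%N (leq_addr _ _) (ltnW id).
  have h2 := hW (i + d)%N (i + d).+1 (leqnSn _) id.
  have h3 := hM (i + d)%N (i + d).+1 (leqnSn _) id.
  have h4 := hM i (i + d)%N (leq_addr _ _) (ltnW id).
  rewrite qS; split; nra.
exists (fun i => q i) => i j.
have -> : w 0 i = W i by rewrite /W inord_val.
have -> : m 0 i = M i by rewrite /M inord_val.
have -> : m 0 j = M j by rewrite /M inord_val.
case: (leqP i j) => [ij|/ltnW ij].
- have := (key i (j - i)%N); rewrite subnKC // => /(_ (ltn_ord j)) [].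
  by [].
- have := (key j (i - j)%N); rewrite subnKC // => /(_ (ltn_ord i)) [].
  by [].
Qed.

(** * Conjugated diagonal matrices and von Neumann's trace inequality *)

Section ConjDiag.
Context {R : realType} {n : nat}.
Implicit Types (U Q : 'M[R]_n) (x y v w m : 'rV[R]_n) (X Y V : symmx R n).

Lemma orthogonal_trmx U : orthogonal_group U -> U^T *m U = 1%:M.
Proof. exact: mulmx1C. Qed.

Lemma orthogonal_groupT U : orthogonal_group U -> orthogonal_group U^T.
Proof. by move=> oU; rewrite /orthogonal_group /= trmxK orthogonal_trmx. Qed.

Lemma orthogonal_groupM U Q :
  orthogonal_group U -> orthogonal_group Q -> orthogonal_group (U *m Q).
Proof.
rewrite /orthogonal_group /= => oU oQ.
by rewrite trmx_mul mulmxA -(mulmxA U) oQ mulmx1.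
Qed.

Lemma orthogonal_row_norm U i : orthogonal_group U -> \sum_j U i j ^+ 2 = 1.
Proof.
move=> oU; have /matrixP/(_ i i) := oU.
rewrite !mxE eqxx mulr1n => <-; apply: eq_bigr => j _.
by rewrite mxE expr2.
Qed.

Lemma mul_diag_mxE (A : 'M[R]_n) x (B : 'M[R]_n) i j :
  (A *m diag_mx x *m B) i j = \sum_k A i k * x 0 k * B k j.
Proof. by rewrite !mxE; apply: eq_bigr => k _; rewrite mul_mx_diag mxE. Qed.

Lemma symmx_sym V i j : (V : 'M[R]_n) i j = (V : 'M[R]_n) j i.
Proof. by case: V => A /= /eqP {2}<-; rewrite mxE. Qed.

Lemma trdot_conj_diagl U x V :
  trdot (conj_diag U x) V = \sum_i x 0 i * (U^T *m V *m U) i i.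
Proof.
rewrite /trdot /= -!mulmxA mxtrace_mulC -!mulmxA /mxtrace.
by apply: eq_bigr => i _; rewrite mul_diag_mx mxE !mulmxA.
Qed.

(** For orthogonal [U] and [Q] the squared entries of [U^T *m Q] form a doubly stochastic matrix, so
    the inner product becomes the cost of a transport plan. *)
Lemma trdot_conj_diag U Q x y :
  trdot (conj_diag U x) (conj_diag Q y) =
  \sum_i \sum_j x 0 i * y 0 j * (U^T *m Q) i j ^+ 2.
Proof.
rewrite trdot_conj_diagl; apply: eq_bigr => i _ /=.
rewrite -!mulmxA (mulmxA U^T) (mulmxA (U^T *m Q)).
have -> : Q^T *m U = (U^T *m Q)^T by rewrite trmx_mul trmxK.
rewrite mul_diag_mxE mulr_sumr; apply: eq_bigr => j _.
move: (U^T *m Q) => P; rewrite mxE; ring.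
Qed.

Lemma trdot_conj_diag_same U x y : orthogonal_group U ->
  trdot (conj_diag U x) (conj_diag U y) = dotv x y.
Proof.
move=> oU; rewrite trdot_conj_diag orthogonal_trmx // /dotv.
apply: eq_bigr => i _; rewrite (bigD1 i) //= big1 ?addr0 => [|j ji].
  by rewrite !mxE eqxx expr1n mulr1.
by rewrite !mxE eq_sym (negPf ji) mulr0n expr0n mulr0.
Qed.

(** Linear programming duality: the potentials dominate each cost [w i * m j] by [p i + q j], and
    unit row and column sums turn this into the sum of [p i + q i], which is [dotv w m]. *)
Lemma trace_inequality U Q w m : orthogonal_group U -> orthogonal_group Q ->
  nonincreasing_vec w -> nonincreasing_vec m ->
  trdot (conj_diag U w) (conj_diag Q m) <= dotv w m.
Proof.
move=> oU oQ hw hm; rewrite trdot_conj_diag.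
set P := U^T *m Q.
have oP : orthogonal_group P by apply: orthogonal_groupM => //; exact: orthogonal_groupT.
have [q hq] := rearrangement_potential hw hm.
apply: (@le_trans _ _
  (\sum_i \sum_j ((w 0 i * m 0 i - q i) * P i j ^+ 2 + q j * P i j ^+ 2))).
  apply: ler_sum => i _; apply: ler_sum => j _.
  rewrite -mulrDl; apply: ler_wpM2r; first exact: sqr_ge0.
  by have := hq i j; lra.
under eq_bigr => i _ do rewrite big_split /= -mulr_sumr orthogonal_row_norm // mulr1.
rewrite big_split /= exchange_big /=.
have cP j : \sum_i q j * P i j ^+ 2 = q j.
  rewrite -mulr_sumr; have cE i : P i j = P^T j i by rewrite [RHS]mxE.
  under eq_bigr do rewrite cE.
  by rewrite (orthogonal_row_norm _ (orthogonal_groupT oP)) mulr1.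
under [X in _ + X]eq_bigr do rewrite cP.
rewrite -big_split /=.
by rewrite /dotv; rewrite le_eqVlt; apply/orP; left; apply/eqP; apply: eq_bigr => i _; rewrite subrK.
Qed.
End ConjDiag.

Lemma increasing_seq_ge (p : nat -> nat) k : increasing_seq p -> (k <= p k)%N.
Proof.
move=> /increasing_seqP p_incr; elim: k => // k IH.
by rewrite (leq_ltn_trans IH) //; exact: p_incr.
Qed.

Lemma cvg_subseq (T : topologicalType) (u : nat -> T) (l : T) (p : nat -> nat) :
  increasing_seq p -> u @ \oo --> l -> (u \o p) @ \oo --> l.
Proof.
move=> p_incr ul; apply: cvg_comp ul => A [N _ NA]; exists N => // k /= Nk.
by apply: NA; rewrite /= (leq_trans Nk) // increasing_seq_ge.
Qed.

(** Bolzano-Weierstrass is applied to one member of the list at a time; members already convergent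
    stay so along a further subsequence. *)
Lemma bounded_family_cvg_subseq (R : realType) (I : eqType) (s : seq I)
    (u : I -> nat -> R) (M : R) :
  (forall i k, `|u i k| <= M) ->
  exists2 p : nat -> nat, increasing_seq p & forall i, i \in s -> cvgn (u i \o p).
Proof.
move=> uM; elim: s => [|i s [p p_incr ps]]; first by exists id.
have [|q q_incr uq] := @bolzano_weierstrass R (u i \o p).
  exists M; split; first exact: num_real.
  by move=> x Mx k _ /=; rewrite (le_trans (uM _ _)) // ltW.
exists (p \o q) => [a b /=|j]; first by rewrite p_incr -leEnat q_incr.
rewrite inE => /predU1P[->|/ps /cvg_ex[l jl]]; first exact: uq.
by apply/cvg_ex; exists l; exact: (cvg_subseq q_incr jl).
Qed.

Lemma cvg_sqrt_sum_sqr (R : realType) (I : finType) (a : I -> nat -> R) :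
  (fun k => Num.sqrt (\sum_i a i k ^+ 2)) @ \oo --> (0 : R) <->
  forall i, a i @ \oo --> (0 : R).
Proof.
split=> [a0 i|a0].
  apply/norm_cvg0P; apply: (@squeeze_cvgr _ _ _ _ (fun=> 0) _ _ _ _ (cvg_cst _) a0).
  apply: nearW => k; rewrite normr_ge0 /= -sqrtr_sqr ler_sqrt; last first.
    by apply: sumr_ge0 => j _; exact: sqr_ge0.
  rewrite (bigD1 i) //= lerDl; apply: sumr_ge0 => j _; exact: sqr_ge0.
rewrite -[X in _ --> X](@sqrtr0 R).
apply: (@continuous_cvg _ _ _ _ _ _ Num.sqrt); first exact: sqrt_continuous.
rewrite [X in _ --> X](_ : 0 = \sum_(i : I) (0 : R)); last by rewrite big1.
apply: cvg_big => [|i _]; first exact: add_continuous.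
rewrite [X in _ --> X](_ : 0 = 0 * 0); last by rewrite mulr0.
by rewrite /= (_ : (fun x => _) = (fun x => a i x * a i x)) //; apply: cvgM.
Qed.

Section EntrywiseConvergence.
Context {R : realType}.

(** Limit rules in [R] carry over directly to products, transposes and traces, and [ecvg] for both
    inner products reduces to this notion. *)
Definition mx_cvg (m n : nat) (A_ : nat -> 'M[R]_(m, n)) (A : 'M[R]_(m, n)) : Prop :=
  forall i j, (fun k => A_ k i j) @ \oo --> A i j.

Lemma mx_cvg_cst m n (A : 'M[R]_(m, n)) : mx_cvg (fun=> A) A.
Proof. by move=> i j; exact: cvg_cst. Qed.

Lemma mx_cvg_tr m n (A_ : nat -> 'M[R]_(m, n)) A :
  mx_cvg A_ A -> mx_cvg (fun k => (A_ k)^T) A^T.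
Proof.
by move=> cA i j; rewrite mxE; under eq_fun do rewrite mxE; exact: cA.
Qed.

Lemma mx_cvg_mul m n p (A_ : nat -> 'M[R]_(m, n)) (B_ : nat -> 'M[R]_(n, p)) A B :
  mx_cvg A_ A -> mx_cvg B_ B -> mx_cvg (fun k => A_ k *m B_ k) (A *m B).
Proof.
move=> cA cB i j; rewrite mxE; under eq_fun do rewrite mxE.
apply: cvg_big => [|l _]; first exact: add_continuous.
exact: cvgM (cA _ _) (cB _ _).
Qed.

Lemma mx_cvg_diag n (x_ : nat -> 'rV[R]_n) x :
  mx_cvg x_ x -> mx_cvg (fun k => diag_mx (x_ k)) (diag_mx x).
Proof.
move=> cx i j; rewrite mxE; under eq_fun do rewrite mxE.
case: eqP => _; first exact: cx.
exact: cvg_cst.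
Qed.

Lemma mx_cvg_unique m n (A_ : nat -> 'M[R]_(m, n)) A B :
  mx_cvg A_ A -> mx_cvg A_ B -> A = B.
Proof. by move=> cA cB; apply/matrixP => i j; exact: (cvg_unique _ (cA i j) (cB i j)). Qed.

Lemma mx_cvg_trace n (A_ : nat -> 'M[R]_n) A :
  mx_cvg A_ A -> (fun k => \tr (A_ k)) @ \oo --> \tr A.
Proof.
move=> cA; apply: cvg_big => [|i _]; first exact: add_continuous.
exact: cA.
Qed.

Lemma mx_cvg_orthogonal n (U_ : nat -> 'M[R]_n) U :
  (forall k, orthogonal_group (U_ k)) -> mx_cvg U_ U -> orthogonal_group U.
Proof.
move=> oU cU; apply: mx_cvg_unique (mx_cvg_mul cU (mx_cvg_tr cU)) _.
by under [X in mx_cvg X _]eq_fun do rewrite oU; exact: mx_cvg_cst.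
Qed.

(** Rows have unit norm, so all entries are bounded by 1 and a common convergent subsequence exists;
    the equation of orthogonality passes to the limit. *)
Lemma orthogonal_cvg_subseq n (U_ : nat -> 'M[R]_n) :
  (forall k, orthogonal_group (U_ k)) ->
  exists p : nat -> nat, increasing_seq p /\
    exists2 U, orthogonal_group U & mx_cvg (U_ \o p) U.
Proof.
move=> oU.
have [p p_incr cp] : exists2 p : nat -> nat, increasing_seq p &
    forall ij, ij \in enum [set: 'I_n * 'I_n]%SET -> cvgn ((fun k => U_ k ij.1 ij.2) \o p).
  apply: (@bounded_family_cvg_subseq _ _ _ (fun ij k => U_ k ij.1 ij.2) 1).
  move=> -[i j] k /=; rewrite -(ler_pXn2r (n := 2)) ?nnegrE // expr1n.
  rewrite real_normK ?num_real // -(orthogonal_row_norm i (oU k)) (bigD1 j) //= lerDl.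
  by apply: sumr_ge0 => l _; exact: sqr_ge0.
exists p; split => //.
pose U : 'M[R]_n := \matrix_(i, j) lim (U_ (p k) i j @[k --> \oo]).
have cU : mx_cvg (U_ \o p) U.
  by move=> i j; rewrite mxE; apply: (cp (i, j)); rewrite mem_enum inE.
exists U => //; apply: mx_cvg_orthogonal cU => k; exact: oU.
Qed.

Lemma enorm_dotvE n (x : 'rV[R]_n) : enorm dotv x = Num.sqrt (\sum_i x 0 i ^+ 2).
Proof. by congr Num.sqrt; apply: eq_bigr => i _; rewrite expr2. Qed.

Lemma enorm_trdotE n (X : symmx R n) :
  enorm trdot X = Num.sqrt (\sum_ij (X : 'M[R]_n) ij.1 ij.2 ^+ 2).
Proof.
congr Num.sqrt; rewrite -(pair_bigA _ (fun i j => (X : 'M[R]_n) i j ^+ 2)) /=.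
apply: eq_bigr => i _; rewrite mxE; apply: eq_bigr => j _.
by rewrite expr2 [in LHS](symmx_sym X j i).
Qed.

Lemma ecvg_dotvP n (x_ : nat -> 'rV[R]_n) x : ecvg dotv x_ x <-> mx_cvg x_ x.
Proof.
rewrite /ecvg; under eq_fun do rewrite enorm_dotvE.
rewrite (@cvg_sqrt_sum_sqr _ _ (fun i k => (x_ k - x) 0 i)); split=> cx i.
  move=> j; rewrite ord1; apply/subr_cvg0.
  by have := cx j; under eq_fun do rewrite !mxE.
by under eq_fun do rewrite !mxE; apply/subr_cvg0; exact: cx.
Qed.

Lemma ecvg_trdotP n (X_ : nat -> symmx R n) X :
  ecvg trdot X_ X <-> mx_cvg (fun k => X_ k : 'M[R]_n) X.
Proof.
rewrite /ecvg; under eq_fun do rewrite enorm_trdotE.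
rewrite (@cvg_sqrt_sum_sqr _ _ (fun ij k => (X_ k - X : 'M[R]_n) ij.1 ij.2)); split=> cX.
  move=> i j; apply/subr_cvg0.
  by have := cX (i, j); under eq_fun do rewrite !mxE.
by move=> ij; under eq_fun do rewrite !mxE; apply/subr_cvg0; exact: cX.
Qed.

End EntrywiseConvergence.

(** * Isospectral perturbations by reflections *)

Section Reflections.
Context {R : realType} {n : nat}.
Implicit Types (U Q : 'M[R]_n) (x d : 'rV[R]_n) (X V W : symmx R n) (z : 'rV[R]_n).

Lemma symmx_eq X V : (X : 'M[R]_n) = V -> X = V.
Proof. exact: val_inj. Qed.

Fact conj_symmx_subproof U V : U^T *m V *m U \in is_symmx.
Proof. by case: V => A /= /eqP sA; rewrite unfold_in !trmx_mul trmxK sA mulmxA. Qed.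

Definition conj_symmx U V : symmx R n := SymMx (conj_symmx_subproof U V).

Lemma trdot_conj_symmx U V Q x :
  trdot (conj_symmx U V) (conj_diag Q x) = trdot V (conj_diag (U *m Q) x).
Proof.
by rewrite /trdot /= trmx_mul -!mulmxA mxtrace_mulC -!mulmxA.
Qed.

Lemma conj_diag_mul U Q x :
  (conj_diag (U *m Q) x : 'M[R]_n) = U *m conj_diag Q x *m U^T.
Proof. by rewrite /= trmx_mul !mulmxA. Qed.

Lemma conj_diag1 x : (conj_diag 1%:M x : 'M[R]_n) = diag_mx x.
Proof. by rewrite /= trmx1 mulmx1 mul1mx. Qed.

Lemma orthogonal_group1 : orthogonal_group (1%:M : 'M[R]_n).
Proof. by rewrite /orthogonal_group /= trmx1 mulmx1. Qed.

(** For [k] the inverse of [dotv z z] this is the reflection in the hyperplane orthogonal to [z]; a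
    free [k] keeps divisions out of the matrix algebra. *)
Definition householder (k : R) z : 'M[R]_n := 1%:M - (2 * k) *: (z^T *m z).

Definition quad z (A : 'M[R]_n) : R := (z *m A *m z^T) 0 0.

Lemma mxtrace_quad z (A : 'M[R]_n) : \tr (A *m (z^T *m z)) = quad z A.
Proof. by rewrite mulmxA mxtrace_mulC mulmxA /quad /mxtrace big_ord1. Qed.

Lemma quadT z (A : 'M[R]_n) : quad z A^T = quad z A.
Proof.
(* The entry of a 1 by 1 matrix is read as the entry of its transpose. *)
rewrite /quad -[LHS](mxE trmx_key (fun i j => (z *m A^T *m z^T) j i)).
by rewrite -[\matrix[_]_(_, _) _]/((z *m A^T *m z^T)^T) !trmx_mul !trmxK mulmxA.
Qed.

Lemma quad_mulmx z (A : 'M[R]_n) : z^T *m z *m A *m (z^T *m z) = quad z A *: (z^T *m z).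
Proof.
rewrite -!mulmxA (mulmxA z A) (mulmxA (z *m A)) [z *m A *m z^T]mx11_scalar.
by rewrite mul_scalar_mx -scalemxAr.
Qed.

Lemma householderT k z : (householder k z)^T = householder k z.
Proof. by rewrite /householder linearB linearZ /= trmx_mul trmxK trmx1. Qed.

Lemma householder_conj k z (A : 'M[R]_n) :
  householder k z *m A *m (householder k z)^T =
  A - (2 * k) *: (z^T *m z *m A + A *m (z^T *m z)) + (4 * k ^+ 2 * quad z A) *: (z^T *m z).
Proof.
rewrite householderT /householder mulmxBl mul1mx mulmxBr mulmx1 mulmxBl.
rewrite -!scalemxAl -!scalemxAr quad_mulmx.
move: (z^T *m z *m A) (A *m (z^T *m z)) (z^T *m z) => B C D.
apply/matrixP => i j; rewrite !mxE; ring.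
Qed.

Lemma householder_orthogonal k z : k * dotv z z = 1 -> orthogonal_group (householder k z).
Proof.
move=> kz; rewrite /orthogonal_group /= -[X in X *m _]mulmx1 householder_conj.
rewrite mulmx1 mul1mx; have -> : quad z 1%:M = dotv z z.
  by rewrite /quad mulmx1 mxE /dotv; apply: eq_bigr => i _; rewrite mxE.
rewrite (_ : 4 * k ^+ 2 * dotv z z = 4 * k); last by rewrite -mulrA expr2 -(mulrA k) kz mulr1.
move: (z^T *m z) => D; apply/matrixP => i j; rewrite !mxE; ring.
Qed.

(* The reflection along [e_i + t e_j]; its direction has squared norm [1 + t^2]. *)
Definition reflection (i j : 'I_n) (t : R) : 'M[R]_n :=
  householder (1 + t ^+ 2)^-1 (delta_mx 0 i + t *: delta_mx 0 j).

(** At [t = 0] the reflection merely flips the sign of coordinate [i], which fixes diagonal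
    matrices; hence this curve of perturbations starts at zero. *)
Definition reflection_diff i j t d : symmx R n :=
  conj_diag (reflection i j t) d - conj_diag 1%:M d.

Lemma quad_delta (i j : 'I_n) t (A : 'M[R]_n) :
  quad (delta_mx 0 i + t *: delta_mx 0 j) A =
  A i i + t * (A i j + A j i) + t ^+ 2 * A j j.
Proof.
rewrite /quad linearD linearZ /= !trmx_delta !mulmxDl !mulmxDr -!scalemxAl -!scalemxAr.
rewrite -!rowE -!colE !mxE; ring.
Qed.

Lemma reflection_orthogonal (i j : 'I_n) t : i != j -> orthogonal_group (reflection i j t).
Proof.
move=> ij; apply: householder_orthogonal.
have -> (z : 'rV[R]_n) : dotv z z = quad z 1%:M.
  by rewrite /quad mulmx1 mxE /dotv; apply: eq_bigr => l _; rewrite mxE.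
rewrite quad_delta !mxE !eqxx (negPf ij) eq_sym (negPf ij) /= !mulr1n !mulr0n.
rewrite addr0 mulr0 addr0 mulr1 mulVf // gt_eqF //.
by have := sqr_ge0 t; lra.
Qed.

Lemma trdot_householder k z d W :
  trdot W (conj_diag (householder k z) d - conj_diag 1%:M d) =
  4 * k ^+ 2 * quad z (diag_mx d) * quad z W - 4 * k * quad z (W *m diag_mx d).
Proof.
rewrite /trdot [GRing.add in LHS]lock /= -lock /= trmx1 mulmx1 mul1mx householder_conj.
set a := _ * quad z _; rewrite addrAC [X in X + _]addrAC subrr add0r.
have t1 : \tr (W *m (z^T *m z *m diag_mx d)) = quad z (W *m diag_mx d).
  rewrite mxtrace_mulC -(mulmxA (z^T *m z)) mxtrace_mulC mxtrace_quad -quadT trmx_mul tr_diag_mx.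
  by case: (W) => A /= /eqP ->.
have t2 : \tr (W *m (diag_mx d *m (z^T *m z))) = quad z (W *m diag_mx d).
  by rewrite mulmxA mxtrace_quad.
have t3 : \tr (W *m (z^T *m z)) = quad z W by rewrite mxtrace_quad.
rewrite mulmxDr mulmxN -!scalemxAr mulmxDr mxtraceD.
rewrite -scaleN1r !mxtraceZ mxtraceD t1 t2 t3; ring.
Qed.

(** To first order in [t] the value is [4 t (d i - d j) W i j], so the curve detects a single
    off-diagonal entry of [W]. *)
Lemma trdot_reflection_diff W (i j : 'I_n) t d : i != j ->
  trdot W (reflection_diff i j t d) =
  4 / (1 + t ^+ 2) ^+ 2 * t * (d 0 i - d 0 j) *
  ((1 - t ^+ 2) * (W : 'M[R]_n) i j +
   t * ((W : 'M[R]_n) j j - (W : 'M[R]_n) i i)).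
Proof.
move=> ij; rewrite /reflection_diff trdot_householder.
rewrite !quad_delta mul_mx_diag !mxE !eqxx (negPf ij) eq_sym (negPf ij).
rewrite /= !mulr1n !mulr0n (symmx_sym W j i).
have k0 : 1 + t ^+ 2 != 0 by rewrite gt_eqF //; have := sqr_ge0 t; lra.
by field.
Qed.

(** The conjugate [H] and [D] have equal norms, so the squared norm of [H - D] is [-2] times the
    inner product of [D] with [H - D], to which the previous formula applies. *)
Lemma trdot_reflection_diff_self (i j : 'I_n) t d : i != j ->
  trdot (reflection_diff i j t d) (reflection_diff i j t d) =
  8 / (1 + t ^+ 2) ^+ 2 * t ^+ 2 * (d 0 i - d 0 j) ^+ 2.
Proof.
move=> ij; pose D := conj_diag 1%:M d; pose H := conj_diag (reflection i j t) d.
have -> : trdot (reflection_diff i j t d) (reflection_diff i j t d) =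
    -2 * trdot D (reflection_diff i j t d).
  have oH := reflection_orthogonal t ij.
  have HH : trdot H H = trdot D D.
    by rewrite /H /D !trdot_conj_diag_same //; exact: orthogonal_group1.
  have HD : trdot H D = trdot D H by rewrite trdotC mul1r.
  rewrite /reflection_diff -/H -/D !(linearBl, linearBr) /= HH HD; ring.
rewrite trdot_reflection_diff // conj_diag1 !mxE !eqxx (negPf ij) /= mulr0n !mulr1n.
ring.
Qed.

Lemma reflection_fixes_diag (i j : 'I_n) t x : i != j -> x 0 i = x 0 j ->
  conj_diag (reflection i j t) x = conj_diag 1%:M x.
Proof.
move=> ij xij; apply/eqP; rewrite -subr_eq0; apply/negP => /negP /trdot_gt0.
by rewrite trdot_reflection_diff_self // xij subrr expr0n mulr0 ltxx.
Qed.

Lemma first_order_le0 (p q : R) :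
  (forall e, 0 < e -> exists2 h, 0 < h &
    forall t, `|t| <= h -> 4 / (1 + t ^+ 2) ^+ 2 * t * ((1 - t ^+ 2) * p + t * q) <= e * `|t|) ->
  p <= 0.
Proof.
move=> pq; rewrite leNgt; apply/negP => p0.
have p4 : 0 < p / 4 by lra.
(* The bound 1/2 makes the prefactor at least 1 and [t ^+ 2] at most 1/4; the last bound gives
   [t * |q| <= p / 8]. The left side is then at least [t * p / 2], too large for [e = p / 4]. *)
have [h h0 /(_ (Num.min h (Num.min 2^-1 (p / (8 * (`|q| + 1))))))] := pq (p / 4) p4.
set t := Num.min h _.
have q1 : 0 < `|q| + 1 by rewrite ltr_wpDl.
have t0 : 0 < t by rewrite !lt_min h0 invr_gt0 ltr0n divr_gt0 // mulr_gt0.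
have th : t <= h by rewrite ge_min lexx.
have t2 : t <= 2^-1 by rewrite !ge_min lexx orbT.
have tq : t * (`|q| + 1) <= p / 8.
  have : t <= p / (8 * (`|q| + 1)) by rewrite !ge_min lexx !orbT.
  by rewrite ler_pdivlMr ?mulr_gt0 // => ?; lra.
rewrite gtr0_norm // => /(_ th).
have qN : - `|q| <= q by rewrite lerNl ler_normr lexx orbT.
rewrite leNgt => /negP; apply.
set k := 4 / _.
have u0 : 0 <= t ^+ 2 by exact: sqr_ge0.
have u4 : t ^+ 2 <= 4^-1 by rewrite expr2; nra.
have k1 : 1 <= k.
  rewrite /k ler_pdivlMr ?exprn_gt0 //; last by lra.
  by move: (t ^+ 2) u0 u4 => u ? ?; nra.
have tqN : - (p / 8) <= t * q by nra.
have b : p / 2 <= (1 - t ^+ 2) * p + t * q by nra.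
apply: (@lt_le_trans _ _ (t * (p / 2))); first by nra.
rewrite -mulrA; apply: (@le_trans _ _ (1 * (t * (p / 2)))); first by rewrite mul1r.
by apply: ler_pM => //; [nra|rewrite ler_pM2l].
Qed.

(** Changing [t] into [- t] reverses the leading term and keeps the second-order one, so a one-sided
    bound excludes both signs of the entry. *)
Lemma offdiag_eq0 W d (i j : 'I_n) : i != j -> d 0 i != d 0 j ->
  (forall e, 0 < e -> exists2 h, 0 < h &
    forall t, `|t| <= h -> trdot W (reflection_diff i j t d) <= e * `|t|) ->
  (W : 'M[R]_n) i j = 0.
Proof.
move=> ij dij hW; set w := (W : 'M[R]_n) i j.
suff : (d 0 i - d 0 j) * w = 0.
  by move=> /eqP; rewrite mulf_eq0 subr_eq0 (negPf dij) => /eqP.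
pose q := (d 0 i - d 0 j) * ((W : 'M[R]_n) j j - (W : 'M[R]_n) i i).
apply/eqP; rewrite eq_le; apply/andP; split; last rewrite -oppr_le0.
  apply: (@first_order_le0 _ q) => e /hW[h h0 hh]; exists h => // t /hh.
  rewrite trdot_reflection_diff // -/w /q; set k := 4 / _.
  by rewrite (_ : k * t * _ * _ = k * t * ((1 - t ^+ 2) * ((d 0 i - d 0 j) * w) + t *
    ((d 0 i - d 0 j) * ((W : 'M[R]_n) j j - (W : 'M[R]_n) i i)))) //; ring.
apply: (@first_order_le0 _ q) => e /hW[h h0 hh]; exists h => // t th.
have := hh (- t); rewrite normrN => /(_ th).
rewrite trdot_reflection_diff // sqrrN -/w /q; set k := 4 / _.
by rewrite (_ : k * (- t) * _ * _ = k * t * ((1 - t ^+ 2) * (- ((d 0 i - d 0 j) * w)) + t *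
  ((d 0 i - d 0 j) * ((W : 'M[R]_n) j j - (W : 'M[R]_n) i i)))) //; ring.
Qed.

End Reflections.

(** * Spectra of conjugated diagonals and diagonalization by maximization *)

Section SimultaneousDiagonalization.
Context {R : realType} {n : nat}.
Implicit Types (U Q : 'M[R]_n) (x y v d : 'rV[R]_n) (X Y V W : symmx R n).

Lemma eigvals_conj_diag_perm U (s : 'S_n) x : orthogonal_group U ->
  nonincreasing_vec (col_perm s x) -> eigvals (conj_diag U x) = col_perm s x.
Proof.
move=> oU xs; symmetry; apply: eigvals_uniq; split => //=.
have uU : U^T \in unitmx by have [] := mulmx1_unit (orthogonal_trmx oU).
have iU : invmx U^T = U.
  by rewrite -[RHS](mulmxK uU) oU mul1mx.
rewrite -[X in X *m _ *m _]iU char_poly_conj // char_poly_trig ?diag_mx_is_trig //.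
rewrite (reindex_inj (@perm_inj _ s)); apply: eq_bigr => i _ /=.
by rewrite !mxE eqxx mulr1n.
Qed.

Lemma eigvals_conj_diag U x : orthogonal_group U ->
  exists s : 'S_n, eigvals (conj_diag U x) = col_perm s x.
Proof.
by move=> oU; have [s xs] := exists_sorting_perm x; exists s; exact: eigvals_conj_diag_perm.
Qed.

Lemma eigvals_nonincreasing X : nonincreasing_vec (eigvals X).
Proof. by have [] := eigvalsP X. Qed.

Lemma eigvals_conj_diag_sorted U x : orthogonal_group U ->
  nonincreasing_vec x -> eigvals (conj_diag U x) = x.
Proof.
by move=> oU sx; rewrite -[RHS](col_perm1 x); apply: eigvals_conj_diag_perm; rewrite ?col_perm1.
Qed.

(** Symmetry of [f] absorbs the sorting of eigenvalues, so unsorted diagonals may be used from here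
    on. *)
Lemma spectral_fun_conj_diag (f : 'rV[R]_n -> \bar R) U x :
  symmetric_fun f -> orthogonal_group U -> f (eigvals (conj_diag U x)) = f x.
Proof. by move=> fs /(eigvals_conj_diag x)[s ->]. Qed.

Lemma dotv_ge0 x : 0 <= dotv x x.
Proof. by apply: sumr_ge0 => i _; rewrite -expr2 sqr_ge0. Qed.

Lemma trdot_ge0 X : 0 <= trdot X X.
Proof. by have [->|/trdot_gt0/ltW//] := eqVneq X 0; rewrite linear0r. Qed.

Lemma enorm_dotv_sqr x : enorm dotv x ^+ 2 = dotv x x.
Proof. by rewrite /enorm sqr_sqrtr //; exact: dotv_ge0. Qed.

Lemma enorm_trdot_sqr X : enorm trdot X ^+ 2 = trdot X X.
Proof. by rewrite /enorm sqr_sqrtr //; exact: trdot_ge0. Qed.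

Lemma le_enorm x X : (enorm dotv x <= enorm trdot X) = (dotv x x <= trdot X X).
Proof. by rewrite -ler_sqr ?nnegrE ?sqrtr_ge0 // enorm_dotv_sqr enorm_trdot_sqr. Qed.

Lemma trdot_le_sqr X Y : trdot X Y <= (trdot X X + trdot Y Y) / 2.
Proof.
have := trdot_ge0 (X - Y).
have XY : trdot Y X = trdot X Y by rewrite trdotC mul1r.
rewrite !(linearBl, linearBr) /= XY; lra.
Qed.

Lemma mx_cvg_conj_diag (U_ : nat -> 'M[R]_n) (x_ : nat -> 'rV[R]_n) U x :
  mx_cvg U_ U -> mx_cvg x_ x ->
  mx_cvg (fun k => conj_diag (U_ k) (x_ k) : 'M[R]_n) (conj_diag U x).
Proof.
move=> cU cx; apply: mx_cvg_mul (mx_cvg_tr cU).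
exact: mx_cvg_mul cU (mx_cvg_diag cx).
Qed.

(* The orbit constraint [conj_diag U x = X] is stable under the reflections that mix
   coordinates [i], [j] with [x i = x j]; maximality against a diagonal matrix with
   distinct entries then kills the corresponding entry of [U^T V U]. *)
Lemma exists_block_diagonalizer V (U0 : 'M[R]_n) x : orthogonal_group U0 ->
  exists U, [/\ orthogonal_group U, conj_diag U x = conj_diag U0 x &
    forall i j, i != j -> x 0 i = x 0 j -> (conj_symmx U V : 'M[R]_n) i j = 0].
Proof.
move=> oU0; pose d : 'rV[R]_n := \row_i (i%:R).
pose S := [set U : 'M[R]_n | orthogonal_group U /\ conj_diag U x = conj_diag U0 x].
pose phi U := trdot V (conj_diag U d).
have S0 : S U0 by [].
have bphi : has_sup [set phi U | U in S].
  split; first by exists (phi U0), U0.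
  exists ((trdot V V + dotv d d) / 2) => _ [U [oU _] <-].
  by apply: le_trans (trdot_le_sqr _ _) _; rewrite trdot_conj_diag_same.
set M := sup [set phi U | U in S] in bphi *.
(* A maximizing sequence: along a convergent subsequence the constraint and [phi] pass to the limit,
   so the supremum is attained at [U]. *)
have /choice[U_ UP] : forall k : nat, exists U, S U /\ M - k.+1%:R^-1 < phi U.
  move=> k; have k0 : (0 : R) < k.+1%:R^-1 by rewrite invr_gt0 ltr0n.
  by have [_ [U SU <-] ltU] := sup_adherent k0 bphi; exists U.
have [p [p_incr [U oU cU]]] := orthogonal_cvg_subseq (fun k => (UP k).1.1).
have SU : S U.
  split => //; apply: symmx_eq.
  have cUx := @mx_cvg_conj_diag _ _ _ _ cU (@mx_cvg_cst R _ _ x).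
  apply: (@mx_cvg_unique _ _ _ _ _ _ cUx); have : mx_cvg (fun=> conj_diag U0 x : 'M[R]_n) (conj_diag U0 x).
    exact: mx_cvg_cst.
  by congr mx_cvg; apply/funext => k; have [[_ ->]] := UP (p k).
have phiU : M <= phi U.
  have cphi : (fun k => phi (U_ (p k))) @ \oo --> phi U.
    apply: mx_cvg_trace; apply: mx_cvg_mul (@mx_cvg_cst R _ _ _) _.
    exact: mx_cvg_conj_diag cU (@mx_cvg_cst R _ _ d).
  have cM : (fun k : nat => M - k.+1%:R^-1) @ \oo --> M.
    rewrite -[X in _ --> X]subr0; apply: cvgB; first exact: cvg_cst.
    exact: cvg_harmonic.
  apply: (ler_cvg_to (cvg_subseq p_incr cM) cphi); apply: nearW => k /=.
  by apply: ltW; have [] := UP (p k).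
have maxU Q : S Q -> phi Q <= phi U.
  by move=> SQ; apply: le_trans phiU; apply: ub_le_sup; [case: bphi|exists Q].
exists U; split; [by []|by case: SU|] => i j ij xij.
apply: (@offdiag_eq0 _ _ _ d) => //.
  by rewrite !mxE (inj_eq (mulrIn (oner_neq0 R))).
(* Maximality makes the left side nonpositive for every [t], so any radius serves. *)
move=> e e0; exists 1 => // t _; apply: (@le_trans _ _ 0); last first.
  by rewrite mulr_ge0 // ltW.
rewrite /reflection_diff linearBr /= !trdot_conj_symmx mulmx1 subr_le0.
apply: maxU; split.
  by apply: orthogonal_groupM => //; exact: reflection_orthogonal.
apply: symmx_eq; rewrite conj_diag_mul reflection_fixes_diag // -conj_diag_mul mulmx1.
by case: SU => _ ->.
Qed.

Lemma conj_symmx_diagonal U V : orthogonal_group U ->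
  (forall i j, i != j -> (conj_symmx U V : 'M[R]_n) i j = 0) ->
  V = conj_diag U (\row_i (conj_symmx U V : 'M[R]_n) i i).
Proof.
move=> oU hd; apply: symmx_eq => /=.
have -> : diag_mx (\row_i (U^T *m V *m U) i i) = U^T *m V *m U.
  apply/matrixP => i j; have [->|ij] := eqVneq i j; first by rewrite !mxE eqxx mulr1n.
  by rewrite [LHS]mxE (negPf ij) mulr0n; have /= -> := hd i j ij.
by rewrite !mulmxA oU mul1mx -mulmxA oU mulmx1.
Qed.

Lemma conj_diag_col_perm (s : 'S_n) U x :
  conj_diag (col_perm s U) (col_perm s x) = conj_diag U x.
Proof.
apply: symmx_eq; apply/matrixP => i j /=.
rewrite !mul_diag_mxE [RHS](reindex_inj (@perm_inj _ s)) /=.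
by apply: eq_bigr => k _; rewrite !mxE.
Qed.

Lemma orthogonal_col_perm (s : 'S_n) U : orthogonal_group U -> orthogonal_group (col_perm s U).
Proof.
rewrite /orthogonal_group /= => <-; apply/matrixP => i j.
rewrite !mxE [RHS](reindex_inj (@perm_inj _ s)) /=.
by apply: eq_bigr => k _; rewrite !mxE.
Qed.

Lemma diagonalizersE X U :
  diagonalizers X U <-> orthogonal_group U /\ conj_diag U (eigvals X) = X.
Proof.
by split=> -[oU UX]; split => //; [exact: symmx_eq|rewrite -[RHS](congr1 symmx_val UX)].
Qed.

(** With the zero vector as constraint all coordinates coincide, so every off-diagonal entry is
    killed; permuting columns then sorts the diagonal. *)
Lemma diagonalizers_nonempty X : diagonalizers X !=set0.
Proof.
have [U [oU _ hU]] := exists_block_diagonalizer X 0 orthogonal_group1.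
have XE : X = conj_diag U (\row_i (conj_symmx U X : 'M[R]_n) i i).
  by apply: conj_symmx_diagonal => // i j ij; apply: hU => //; rewrite !mxE.
set x := \row_i _ in XE.
have [s xs] := exists_sorting_perm x.
have oS : orthogonal_group (col_perm s U) by exact: orthogonal_col_perm.
exists (col_perm s U); apply/diagonalizersE; split => //.
by rewrite {1}XE -(conj_diag_col_perm s U) eigvals_conj_diag_sorted // conj_diag_col_perm -XE.
Qed.

(** * The quadratic minorant and Lipschitz continuity of eigenvalues *)

Lemma sorting_multiplier x v : exists2 t : R, 0 <= t &
  forall i j, x 0 i < x 0 j -> v 0 i + t * x 0 i < v 0 j + t * x 0 j.
Proof.
(* Beyond [c i j] the gap of [x] strictly outweighs that of [v], thanks to the added 1. Ties in [x]
   give [c i j = 0], division by zero being zero, so summing over all pairs is harmless. *)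
pose c i j := (`|v 0 i - v 0 j| + 1) / `|x 0 j - x 0 i|.
have c0 i j : 0 <= c i j by rewrite divr_ge0 // addr_ge0.
exists (\sum_i \sum_j c i j).
  by apply: sumr_ge0 => i _; apply: sumr_ge0 => j _; exact: c0.
move=> i j xij; set t := \sum_k _.
have ct : c i j <= t.
  rewrite /t (bigD1 i) //= (bigD1 j) //= -addrA lerDl addr_ge0 //.
    by apply: sumr_ge0 => k _; exact: c0.
  by apply: sumr_ge0 => k _; apply: sumr_ge0 => l _; exact: c0.
have xx : 0 < x 0 j - x 0 i by rewrite subr_gt0.
move: ct; rewrite /c (gtr0_norm xx) ler_pdivrMr //.
have : v 0 i - v 0 j <= `|v 0 i - v 0 j| by exact: ler_norm.
lra.
Qed.

Lemma dotv_col_perm (s : 'S_n) x y : dotv (col_perm s x) (col_perm s y) = dotv x y.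
Proof.
rewrite /dotv [RHS](reindex_inj (@perm_inj _ s)).
by apply: eq_bigr => i _; rewrite !mxE.
Qed.

Lemma trdot_sqrB X Y : trdot (X - Y) (X - Y) = trdot X X + trdot Y Y - 2 * trdot X Y.
Proof.
have XY : trdot Y X = trdot X Y by rewrite trdotC mul1r.
by rewrite !(linearBl, linearBr) /= XY; ring.
Qed.

Lemma dotv_sqrB x y : dotv (x - y) (x - y) = dotv x x + dotv y y - 2 * dotv x y.
Proof.
have xy : dotv y x = dotv x y by rewrite dotvC mul1r.
by rewrite !(linearBl, linearBr) /= xy; ring.
Qed.

Lemma trdot_self_eigvals X : trdot X X = dotv (eigvals X) (eigvals X).
Proof.
have [U /diagonalizersE[oU UX]] := diagonalizers_nonempty X.
by rewrite -{1 2}UX trdot_conj_diag_same.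
Qed.

(* A permutation [s] sorting [v + t x] also sorts [x] once [t] is large; the trace
   inequality for both vectors against the eigenvalues of [Y] gives the two bounds. *)
Lemma eigvals_minorant U x v : orthogonal_group U -> exists2 t : R, 0 <= t &
  exists s : 'S_n, forall Y, let y := col_perm s (eigvals Y) in
    trdot (conj_diag U v) (Y - conj_diag U x)
      - t / 2 * trdot (Y - conj_diag U x) (Y - conj_diag U x) <= dotv v (y - x) /\
    dotv (y - x) (y - x) <= trdot (Y - conj_diag U x) (Y - conj_diag U x).
Proof.
move=> oU; have [t t0 ht] := sorting_multiplier x v; exists t => //.
have [s hs] := exists_sorting_perm (v + t *: x).
have hx : nonincreasing_vec (col_perm s x).
  move=> i j /hs; rewrite !mxE leNgt => /negP h; rewrite leNgt; apply/negP => /ht.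
  exact: h.
(* The inverse arranges [y] so that the same [s] sorts [y], [x] and [v + t *: x]. *)
exists (s^-1)%g => Y y.
have ys : eigvals Y = col_perm s y.
  by apply/rowP => i; rewrite !mxE permK.
have [Q /diagonalizersE[oQ QY]] := diagonalizers_nonempty Y.
have oUs : orthogonal_group (col_perm s U) by exact: orthogonal_col_perm.
have tr z : nonincreasing_vec (col_perm s z) -> trdot (conj_diag U z) Y <= dotv z y.
  move=> hz; rewrite -(conj_diag_col_perm s) -QY -(dotv_col_perm s) -ys.
  exact: trace_inequality hz (eigvals_nonincreasing Y).
have YY : trdot Y Y = dotv y y by rewrite trdot_self_eigvals ys dotv_col_perm.
have trx := tr x hx; have := tr _ hs.
have -> : trdot (conj_diag U (v + t *: x)) Y =
    trdot (conj_diag U v) Y + t * trdot (conj_diag U x) Y.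
  by rewrite -linearZl_LR -linearDl /=; congr trdot; apply: symmx_eq => /=; 
     rewrite linearD linearZ /= mulmxDr mulmxDl -scalemxAr -scalemxAl.
rewrite linearDl linearZl_LR /= => trv.
rewrite trdot_sqrB dotv_sqrB YY linearBr /= [in X in _ <= X]linearBr /=.
rewrite !trdot_conj_diag_same //.
have -> : trdot Y (conj_diag U x) = trdot (conj_diag U x) Y by rewrite trdotC mul1r.
have yx : dotv y x = dotv x y by rewrite dotvC mul1r.
(* This is [t] times the squared norm of [y - x]; it absorbs the term [t * dotv x y] left by the
   trace inequality for [v + t *: x]. *)
have : 0 <= t * (dotv y y + dotv x x - 2 * dotv x y).
  by rewrite mulr_ge0 // -yx -dotv_sqrB dotv_ge0.
rewrite yx; split; lra.
Qed.

(** Squared norms depend on eigenvalues only, so after expansion just the cross terms remain, and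
    these are compared by the trace inequality. *)
Lemma eigvals_lipschitz X Y :
  enorm dotv (eigvals Y - eigvals X) <= enorm trdot (Y - X).
Proof.
have [U /diagonalizersE[oU UX]] := diagonalizers_nonempty X.
have [Q /diagonalizersE[oQ QY]] := diagonalizers_nonempty Y.
rewrite le_enorm trdot_sqrB dotv_sqrB -!trdot_self_eigvals.
have := trace_inequality oQ oU (eigvals_nonincreasing Y) (eigvals_nonincreasing X).
rewrite UX QY; lra.
Qed.

End SimultaneousDiagonalization.

(** * Proximal and Fréchet subgradients of spectral functions *)

Section SpectralSubdifferentials.
Context {R : realType} {n : nat}.
Implicit Types (U Q : 'M[R]_n) (x y v w d : 'rV[R]_n) (X Y V W : symmx R n).

Lemma proximal_sub_frechet (E : vectType R) (ip : {dot E for idfun}) (g : E -> \bar R) (xbar : E) :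
  proximal_subdiff ip g xbar `<=` frechet_subdiff ip g xbar.
Proof.
move=> v [gx [r [h [r0 h0 hv]]]]; split=> // e e0.
(* Within radius [2 * e / r] the quadratic error is at most [e] times the distance. *)
exists (Num.min h (2 * e / r)); first by rewrite lt_min h0 divr_gt0 // mulr_gt0.
move=> y; rewrite le_min => /andP[yh yr]; apply: le_trans (hv y yh).
apply: leeB => //; rewrite lee_fin.
have := sqrtr_ge0 (ip (y - xbar) (y - xbar)); rewrite -/(enorm ip (y - xbar)).
move: (enorm ip (y - xbar)) yr => N; rewrite ler_pdivlMr // => *; nra.
Qed.

Lemma conj_diagB U x y : conj_diag U x - conj_diag U y = conj_diag U (x - y).
Proof. by apply: symmx_eq; rewrite /= linearB /= mulmxBr mulmxBl. Qed.

Lemma conj_diagZ U (a : R) x : a *: conj_diag U x = conj_diag U (a *: x).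
Proof. by apply: symmx_eq; rewrite /= linearZ /= -scalemxAr -scalemxAl. Qed.

Lemma enorm_conj_diag U x : orthogonal_group U -> enorm trdot (conj_diag U x) = enorm dotv x.
Proof. by move=> oU; rewrite /enorm; congr Num.sqrt; exact: trdot_conj_diag_same. Qed.

Lemma trdot_conj_symmx_same U V W : orthogonal_group U ->
  trdot (conj_symmx U V) (conj_symmx U W) = trdot V W.
Proof.
move=> oU; rewrite /trdot /= -!mulmxA mxtrace_mulC -!mulmxA.
by rewrite (mulmxA U) oU mul1mx mulmx1.
Qed.

Section SymmetricFunction.
Context (f : 'rV[R]_n -> \bar R) (fs : symmetric_fun f).

Let specE U x : orthogonal_group U -> (f \o eigvals) (conj_diag U x) = f x.
Proof. exact: spectral_fun_conj_diag. Qed.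

Lemma spectral_minorant U x v : orthogonal_group U -> exists2 t : R, 0 <= t &
  forall Y, exists y, [/\ f y = f (eigvals Y),
    enorm dotv (y - x) <= enorm trdot (Y - conj_diag U x) &
    trdot (conj_diag U v) (Y - conj_diag U x)
      - t / 2 * enorm trdot (Y - conj_diag U x) ^+ 2 <= dotv v (y - x)].
Proof.
move=> oU; have [t t0 [s hs]] := eigvals_minorant x v oU; exists t => // Y.
exists (col_perm s (eigvals Y)); have [hs1 hs2] := hs Y.
by split; [exact: fs|rewrite le_enorm|rewrite enorm_trdot_sqr].
Qed.

(* [N], [M] stand for the distances of [Y] to [X] and of [y] to [x]. *)
Let frechet_arith (e t N M a b c : R) : 0 < e -> 0 <= t -> 0 <= M -> M <= N ->
  N * (t + 1) <= e -> a - t / 2 * N ^+ 2 <= b -> c + a - e * N <= c + b - e / 2 * M.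
Proof.
move=> e0 t0 M0 MN hN ab.
have : 0 <= N * (e - N * (t + 1)) by rewrite mulr_ge0 ?subr_ge0 // (le_trans M0).
have : 0 <= e * (N - M) by rewrite mulr_ge0 ?subr_ge0 // ltW.
have : 0 <= N * N by rewrite -expr2 sqr_ge0.
rewrite expr2 in ab; lra.
Qed.

Let proximal_arith (r t N M a b c : R) : 0 < r -> 0 <= t -> 0 <= M -> M <= N ->
  a - t / 2 * N ^+ 2 <= b -> c + a - (r + t) / 2 * N ^+ 2 <= c + b - r / 2 * M ^+ 2.
Proof.
move=> r0 t0 M0 MN ab.
have : M ^+ 2 <= N ^+ 2 by rewrite ler_sqr ?nnegrE // (le_trans M0).
move=> MN2; have : 0 <= r * (N ^+ 2 - M ^+ 2) by rewrite mulr_ge0 ?subr_ge0 // ltW.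
lra.
Qed.

Lemma frechet_conj_diag U x v : orthogonal_group U ->
  frechet_subdiff dotv f x v ->
  frechet_subdiff trdot (f \o eigvals) (conj_diag U x) (conj_diag U v).
Proof.
move=> oU [fx hv]; split; first by rewrite specE.
move=> e e0; have [t t0 hs] := spectral_minorant x v oU.
(* Half of [e] pays for the remainder of [f], the other half for the quadratic term of the minorant
   within radius [e / (t + 1)]. *)
have e2 : 0 < e / 2 by rewrite divr_gt0.
have [h h0 hf] := hv _ e2.
exists (Num.min h (e / (t + 1))); first by rewrite lt_min h0 divr_gt0 // ltr_wpDl.
move=> Y; rewrite le_min ler_pdivlMr ?ltr_wpDl // => /andP[Yh Yt].
rewrite specE //=; have [y [<- yY hy]] := hs Y.
apply: le_trans (hf y (le_trans yY Yh)).
rewrite -(fineK fx) -!EFinD lee_fin.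
by apply: frechet_arith hy; rewrite ?sqrtr_ge0.
Qed.

Lemma proximal_conj_diag U x v : orthogonal_group U ->
  proximal_subdiff dotv f x v ->
  proximal_subdiff trdot (f \o eigvals) (conj_diag U x) (conj_diag U v).
Proof.
move=> oU [fx [r [h [r0 h0 hf]]]]; split; first by rewrite specE.
have [t t0 hs] := spectral_minorant x v oU.
exists (r + t), h; split=> //; first by rewrite ltr_wpDr.
move=> Y Yh; rewrite specE //=; have [y [<- yY hy]] := hs Y.
apply: le_trans (hf y (le_trans yY Yh)).
rewrite -(fineK fx) -!EFinD lee_fin.
by apply: proximal_arith hy; rewrite ?sqrtr_ge0.
Qed.

(** It suffices to test at the matrices [conj_diag U y]: this map of [y] is a linear isometry that
    pulls [f \o eigvals] back to [f]. *)
Lemma frechet_of_conj_diag U x v : orthogonal_group U ->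
  frechet_subdiff trdot (f \o eigvals) (conj_diag U x) (conj_diag U v) ->
  frechet_subdiff dotv f x v.
Proof.
move=> oU []; rewrite specE // => fx hv; split=> // e /hv[h h0 hf]; exists h => // y.
rewrite -(enorm_conj_diag _ oU) -conj_diagB => /hf.
by rewrite specE // conj_diagB /= trdot_conj_diag_same.
Qed.

Lemma proximal_of_conj_diag U x v : orthogonal_group U ->
  proximal_subdiff trdot (f \o eigvals) (conj_diag U x) (conj_diag U v) ->
  proximal_subdiff dotv f x v.
Proof.
move=> oU []; rewrite specE // => fx [r [h [r0 h0 hf]]]; split=> //.
exists r, h; split=> // y; rewrite -(enorm_conj_diag _ oU) -conj_diagB => /hf.
by rewrite specE // conj_diagB /= trdot_conj_diag_same.
Qed.

(* Conjugating [X] by reflections does not change its spectrum, so the subgradient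
   inequality forces the off-diagonal entries of [U^T V U] to vanish to first order. *)
Lemma frechet_simultaneous X V :
  frechet_subdiff trdot (f \o eigvals) X V ->
  exists2 U, diagonalizers X U & exists v, V = conj_diag U v.
Proof.
move=> [FX hV]; set x := eigvals X.
have [U0 /diagonalizersE[oU0 U0X]] := diagonalizers_nonempty X.
have [U [oU UX hU]] := exists_block_diagonalizer V x oU0.
exists U; first by apply/diagonalizersE; rewrite UX.
exists (\row_i (conj_symmx U V : 'M[R]_n) i i).
apply: conj_symmx_diagonal => // i j ij.
have [xij|xij] := eqVneq (x 0 i) (x 0 j); first exact: hU.
apply: (offdiag_eq0 ij xij) => e e0.
(* A Lipschitz constant at [t = 0] for the curve [Y] below: the squared distance to [X] has factor
   8, rounded up to 9. *)
pose c := 3 * `|x 0 i - x 0 j|.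
have c0 : 0 < c by rewrite mulr_gt0 // normr_gt0 subr_eq0.
have [h h0 hF] := hV (e / c) (divr_gt0 e0 c0).
exists (h / c) => [|t]; first exact: divr_gt0.
rewrite ler_pdivlMr // => th.
have oUH : orthogonal_group (U *m reflection i j t).
  by apply: orthogonal_groupM => //; exact: reflection_orthogonal.
pose Y := conj_diag (U *m reflection i j t) x.
have XU : X = conj_diag U x by rewrite UX.
have YXE : Y - X = conj_symmx U^T (reflection_diff i j t x).
  rewrite /Y /reflection_diff {1}XU; move: (reflection i j t) => H.
  apply: symmx_eq; rewrite /= trmxK trmx_mul trmx1 mulmx1 mul1mx.
  by rewrite mulmxBr mulmxBl !mulmxA.
have normYX : enorm trdot (Y - X) <= c * `|t|.
  have ct0 : 0 <= c * `|t| by rewrite mulr_ge0 // ltW.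
  rewrite -ler_sqr ?nnegrE ?sqrtr_ge0 // enorm_trdot_sqr YXE.
  rewrite trdot_conj_symmx_same; last exact: orthogonal_groupT.
  rewrite trdot_reflection_diff_self // /c !exprMn !real_normK ?num_real //.
  set a := (_ - _) ^+ 2; set b := t ^+ 2.
  have b0 : 0 <= b by exact: sqr_ge0.
  have a0 : 0 <= a by exact: sqr_ge0.
  have k1 : 8 / (1 + b) ^+ 2 <= 9.
    by rewrite ler_pdivrMr ?exprn_gt0 ?ltr_wpDr //; nra.
  have ab : 0 <= b * a by exact: mulr_ge0.
  rewrite -mulrA (_ : 3 ^+ 2 * a * b = 9 * (b * a)); last by ring.
  exact: ler_wpM2r.
have dYX : trdot (conj_symmx U V) (reflection_diff i j t x) = trdot V (Y - X).
  by rewrite /reflection_diff !linearBr /= !trdot_conj_symmx mulmx1 -XU.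
have := hF Y; rewrite (le_trans normYX) 1?mulrC // => /(_ erefl).
have -> : (f \o eigvals) Y = (f \o eigvals) X by rewrite specE.
rewrite -(fineK FX) -!EFinD lee_fin dYX /=.
have : e / c * enorm trdot (Y - X) <= e * `|t|.
  by rewrite mulrAC ler_pdivrMr // -mulrA ler_pM2l // mulrC.
lra.
Qed.

Lemma frechet_spectral X :
  frechet_subdiff trdot (f \o eigvals) X
    = [set conj_diag U v | U in diagonalizers X & v in frechet_subdiff dotv f (eigvals X)].
Proof.
apply/seteqP; split=> [V hV|_ [U /diagonalizersE[oU UX] [v hv <-]]]; last first.
  by rewrite -{1}UX; exact: frechet_conj_diag.
have [U UX [v VE]] := frechet_simultaneous hV; have [oU XE] := (diagonalizersE X U).1 UX.
exists U => //; exists v => //; apply: (frechet_of_conj_diag oU).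
by rewrite XE -VE.
Qed.

Lemma proximal_spectral X :
  proximal_subdiff trdot (f \o eigvals) X
    = [set conj_diag U v | U in diagonalizers X & v in proximal_subdiff dotv f (eigvals X)].
Proof.
apply/seteqP; split=> [V hV|_ [U /diagonalizersE[oU UX] [v hv <-]]]; last first.
  by rewrite -{1}UX; exact: proximal_conj_diag.
have [U UX [v VE]] := frechet_simultaneous (proximal_sub_frechet hV).
have [oU XE] := (diagonalizersE X U).1 UX.
exists U => //; exists v => //; apply: (proximal_of_conj_diag oU).
by rewrite XE -VE.
Qed.

(** * Limiting and horizon subdifferentials by compactness *)

Lemma ecvg_conj_diag U (x_ : nat -> 'rV[R]_n) x : orthogonal_group U ->
  ecvg dotv x_ x -> ecvg trdot (fun k => conj_diag U (x_ k)) (conj_diag U x).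
Proof.
move=> oU; rewrite /ecvg.
have -> // : (fun k => enorm trdot (conj_diag U (x_ k) - conj_diag U x)) =
    (fun k => enorm dotv (x_ k - x)).
by apply/funext => k; rewrite conj_diagB enorm_conj_diag.
Qed.

Lemma ecvg_eigvals (X_ : nat -> symmx R n) X :
  ecvg trdot X_ X -> ecvg dotv (fun k => eigvals (X_ k)) (eigvals X).
Proof.
move=> cX; apply: (squeeze_cvgr _ (cvg_cst 0) cX); apply: nearW => k.
by rewrite sqrtr_ge0 eigvals_lipschitz.
Qed.

(** The compactness argument shared by both cases. Once the [U_] converge, so do the [v_], being the
    diagonals of the convergent matrices conjugated back by [U_]. *)
Lemma diagonalizers_cvg_subseq (X_ : nat -> symmx R n) X (U_ : nat -> 'M[R]_n)
    (v_ : nat -> 'rV[R]_n) V :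
  ecvg trdot X_ X -> (forall k, diagonalizers (X_ k) (U_ k)) ->
  ecvg trdot (fun k => conj_diag (U_ k) (v_ k)) V ->
  exists p : nat -> nat, [/\ increasing_seq p, ecvg dotv (fun k => eigvals (X_ (p k))) (eigvals X) &
    exists2 U, diagonalizers X U & exists2 v, V = conj_diag U v & ecvg dotv (v_ \o p) v].
Proof.
move=> cX dU cV.
have oU_ k : orthogonal_group (U_ k) by case: (dU k).
have [p [p_incr [U oU cU]]] := orthogonal_cvg_subseq oU_.
have cXp : ecvg trdot (X_ \o p) X by exact: (cvg_subseq p_incr cX).
have cVp : ecvg trdot (fun k => conj_diag (U_ (p k)) (v_ (p k))) V.
  exact: (cvg_subseq p_incr cV).
have cl := ecvg_eigvals cXp.
exists p; split=> //; exists U.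
  apply/diagonalizersE; split=> //; apply: symmx_eq.
  have cUl : mx_cvg (fun k => conj_diag (U_ (p k)) (eigvals (X_ (p k))) : 'M[R]_n)
      (conj_diag U (eigvals X)).
    by apply: mx_cvg_conj_diag => //; apply/ecvg_dotvP.
  apply: (mx_cvg_unique cUl); have /ecvg_trdotP := cXp; congr mx_cvg.
  by apply/funext => k; have /diagonalizersE[_ ->] := dU (p k).
pose v : 'rV[R]_n := \row_i (U^T *m V *m U) i i.
have vp : mx_cvg (v_ \o p) v.
  have cUT := mx_cvg_tr cU; have /ecvg_trdotP cVm := cVp.
  have cM := mx_cvg_mul (mx_cvg_mul cUT cVm) cU.
  move=> i j; rewrite ord1 [X in _ --> X]mxE.
  have -> : (fun k => (v_ \o p) k 0 j) = (fun k =>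
      (((U_ \o p) k)^T *m conj_diag (U_ (p k)) (v_ (p k)) *m (U_ \o p) k) j j).
    apply/funext => k /=; have oUk := orthogonal_trmx (oU_ (p k)).
    by rewrite !mulmxA oUk mul1mx -mulmxA oUk mulmx1 mxE eqxx mulr1n.
  exact: cM.
exists v; last by apply/ecvg_dotvP.
apply: symmx_eq; have cUv := @mx_cvg_conj_diag _ _ _ _ _ _ cU vp.
by apply: mx_cvg_unique cUv; apply/ecvg_trdotP.
Qed.

Lemma limiting_conj_diag U x v : orthogonal_group U ->
  limiting_subdiff dotv f x v ->
  limiting_subdiff trdot (f \o eigvals) (conj_diag U x) (conj_diag U v).
Proof.
move=> oU [fx [x_ [v_ [hv cx cf cv]]]]; split; first by rewrite specE.
exists (fun k => conj_diag U (x_ k)), (fun k => conj_diag U (v_ k)); split.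
- by move=> k; exact: frechet_conj_diag.
- exact: ecvg_conj_diag.
- by rewrite specE //; under eq_fun do rewrite specE //.
- exact: ecvg_conj_diag.
Qed.

Lemma limiting_spectral X :
  limiting_subdiff trdot (f \o eigvals) X
    = [set conj_diag U v | U in diagonalizers X & v in limiting_subdiff dotv f (eigvals X)].
Proof.
apply/seteqP; split=> [V|_ [U /diagonalizersE[oU UX] [v hv <-]]]; last first.
  by rewrite -{1}UX; exact: limiting_conj_diag.
move=> [FX [X_ [V_ [hV cX cF cV]]]].
have /choice[Uv_ UvP] : forall k, exists Uv : 'M[R]_n * 'rV[R]_n,
    [/\ diagonalizers (X_ k) Uv.1, frechet_subdiff dotv f (eigvals (X_ k)) Uv.2 &
        V_ k = conj_diag Uv.1 Uv.2].
  move=> k; have := hV k; rewrite frechet_spectral => -[U dU [v fv <-]].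
  by exists (U, v).
have cV' : ecvg trdot (fun k => conj_diag (Uv_ k).1 (Uv_ k).2) V.
  rewrite (_ : (fun k => _) = V_) //.
  by apply/funext => k; case: (UvP k).
have dU k : diagonalizers (X_ k) (Uv_ k).1 by case: (UvP k).
have [p [p_incr cl [U UX [v VE cv]]]] := diagonalizers_cvg_subseq cX dU cV'.
exists U => //; exists v => //; split=> //.
exists (fun k => eigvals (X_ (p k))), (fun k => (Uv_ (p k)).2); split.
- by move=> k; case: (UvP (p k)).
- exact: cl.
- exact: (cvg_subseq p_incr cF).
- exact: cv.
Qed.

Lemma horizon_spectral X :
  horizon_subdiff trdot (f \o eigvals) X
    = [set conj_diag U v | U in diagonalizers X & v in horizon_subdiff dotv f (eigvals X)].
Proof.
apply/seteqP; split=> [V|_ [U /diagonalizersE[oU UX] [w hw <-]]]; last first.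
  rewrite -{1}UX; case: hw => fx [x_ [v_ [t_ [hv t0 cx ct cw]]]].
  split; first by rewrite specE.
  exists (fun k => conj_diag U (x_ k)), (fun k => conj_diag U (v_ k)), t_; split.
  - by move=> k; exact: limiting_conj_diag.
  - exact: t0.
  - exact: ecvg_conj_diag.
  - exact: ct.
  - under eq_fun do rewrite conj_diagZ.
    exact: ecvg_conj_diag oU cw.
move=> [FX [X_ [V_ [t_ [hV t0 cX [tdec ct] cV]]]]].
have /choice[Uv_ UvP] : forall k, exists Uv : 'M[R]_n * 'rV[R]_n,
    [/\ diagonalizers (X_ k) Uv.1, limiting_subdiff dotv f (eigvals (X_ k)) Uv.2 &
        V_ k = conj_diag Uv.1 Uv.2].
  move=> k; have := hV k; rewrite limiting_spectral => -[U dU [v fv <-]].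
  by exists (U, v).
(* The factor [t_ k] is moved inside the diagonal, since only the scaled subgradients are known to
   converge. *)
have cV' : ecvg trdot (fun k => conj_diag (Uv_ k).1 (t_ k *: (Uv_ k).2)) V.
  rewrite (_ : (fun k => _) = (fun k => t_ k *: V_ k)) //.
  by apply/funext => k; rewrite -conj_diagZ; case: (UvP k) => _ _ ->.
have dU k : diagonalizers (X_ k) (Uv_ k).1 by case: (UvP k).
have [p [p_incr cl [U UX [w VE cw]]]] := diagonalizers_cvg_subseq cX dU cV'.
exists U => //; exists w => //; split=> //.
exists (fun k => eigvals (X_ (p k))), (fun k => (Uv_ (p k)).2), (t_ \o p); split.
- by move=> k; case: (UvP (p k)).
- by move=> k; exact: t0.
- exact: cl.
- split; last exact: (cvg_subseq p_incr ct).
  by move=> a b ab; apply: tdec; rewrite -leEnat p_incr.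
- exact: cw.
Qed.

End SymmetricFunction.

End SpectralSubdifferentials.

Theorem theorem4p2 (R : realType) (n : nat) (f : 'rV[R]_n -> \bar R)
    (X : symmx R n) :
  lower_semicontinuous f ->
  symmetric_fun f ->
  f (eigvals X) \is a fin_num ->
  [/\ limiting_subdiff trdot (f \o eigvals) X
        = [set conj_diag U v | U in diagonalizers X &
                               v in limiting_subdiff dotv f (eigvals X)],
      proximal_subdiff trdot (f \o eigvals) X
        = [set conj_diag U v | U in diagonalizers X &
                               v in proximal_subdiff dotv f (eigvals X)],
      frechet_subdiff trdot (f \o eigvals) X
        = [set conj_diag U v | U in diagonalizers X &
                               v in frechet_subdiff dotv f (eigvals X)] &
      horizon_subdiff trdot (f \o eigvals) X
        = [set conj_diag U v | U in diagonalizers X &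
                               v in horizon_subdiff dotv f (eigvals X)]].
Proof.
move=> _ fs _; split.
- exact: limiting_spectral.
- exact: proximal_spectral.
- exact: frechet_spectral.
- exact: horizon_spectral.
Qed.
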